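(* Let $P$ be a finite poset with minimum $\hat0$ and maximum $\hat1$, and let $P'$ be obtained from $P$ by zipping a clean zipper $(x,y,z)$. If $\Delta(\overline{P})$ is a PL $d$-ball, then so is $\Delta(\overline{P'})$.
   Context: $\overline{P}=P-\{\hat0,\hat1\}$ and $\Delta(\cdot)$ denotes the order complex (simplicial complex of chains). Let $\mathbf{2}=\{\alpha<\beta\}$ be the two-element chain. A zipper in $P$ is a triple $(x,y,z)$ of distinct elements such that $z$ covers only $x$ and $y$, $z=x\vee y$ (the join), and $[\hat0,x)=[\hat0,y)$. It is proper if $z\neq\hat1$, and clean if it is proper and there exist a coatom $c$ (element covered by $\hat1$) and a poset isomorphism $\varphi:[x,\hat1]\to[x,c]\times\mathbf{2}$ with $\varphi(z)=(x,\beta)$. Zipping a proper zipper produces $P'=(P-\{x,y,z\})\uplus\{xyz\}$ with order $\leq'$: $a\leq' b$ if $a\leq b$ (for $a,b\in P-\{x,y,z\}$); $xyz\leq' a$ if $x\leq a$ or $y\leq a$; $a\leq' xyz$ if $a\leq x$ (equivalently $a\leq y$); and $xyz\leq' xyz$. A PL $d$-ball is a simplicial complex PL homeomorphic to a $d$-simplex. *)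

(* Defs.v *)
From HB Require Import structures.
From mathcomp Require Import all_boot all_order all_algebra.
From mathcomp Require Import reals.

Set Implicit Arguments.
Unset Strict Implicit.
Unset Printing Implicit Defensive.

Import Order.TTheory GRing.Theory Num.Theory.

Local Open Scope order_scope.

Section Zippers.
Variables (disp : Order.disp_t) (P : finTBPOrderType disp).
Implicit Types u v w x y z c : P.

Definition covers v u := (u < v) && [forall w, ~~ (u < w < v)].

Definition coatom c := covers \top c.

Definition is_join x y z := forall w, (z <= w) = (x <= w) && (y <= w).

Record zipper x y z : Prop := Zipper {
  zipper_uniq : uniq [:: x; y; z];
  zipper_covers : forall w, covers z w = (w == x) || (w == y);
  zipper_join : is_join x y z;
  zipper_below : forall w, (\bot <= w < x) = (\bot <= w < y) }.

Record proper_zipper x y z : Prop := ProperZipper {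
  proper_zipper_zipper :> zipper x y z;
  proper_zipper_top : z != \top }.

End Zippers.

(* phi is only constrained on A; an order embedding is automatically          *)
(* injective, so phi is a bijection from A onto B.                            *)
Definition poset_iso_on (d1 d2 : Order.disp_t) (P : porderType d1)
    (Q : porderType d2) (A : {pred P}) (B : {pred Q}) (phi : P -> Q) : Prop :=
  [/\ {in A, forall v, phi v \in B},
      {in A &, {mono phi : u v / u <= v}}
    & {in B, forall w, exists2 v, v \in A & phi v = w}].

(* The chain 2 = {alpha < beta} is bool, with alpha = false, beta = true.     *)
Record clean_zipper (disp : Order.disp_t) (P : finTBPOrderType disp)
    (x y z : P) : Prop := CleanZipper {
  clean_zipper_proper :> proper_zipper x y z;
  clean_zipper_iso : exists (c : P) (phi : P -> P *p bool),
    [/\ coatom c,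
        poset_iso_on [pred v | x <= v <= \top]
                     [pred w : P *p bool | x <= w.1 <= c] phi
      & phi z = (x, true)] }.

(* None is the new element xyz; Some v stands for v in P - {x, y, z}.         *)
Definition zipping (disp : Order.disp_t) (P : finTBPOrderType disp) (x y z : P)
  of proper_zipper x y z : Type := option {v : P | v \notin [:: x; y; z]}.

Section ZippingOrder.
Variables (disp : Order.disp_t) (P : finTBPOrderType disp) (x y z : P).
Variable hz : proper_zipper x y z.
Local Notation P' := (zipping hz).
Implicit Types a b : P'.

HB.instance Definition _ := Finite.on P'.

Definition zip_le a b : bool :=
  match a, b with
  | Some u, Some v => val u <= val v
  | None, Some v => (x <= val v) || (y <= val v)
  | Some u, None => val u <= x
  | None, None => true
  end.

Lemma zipper_lt : (x < z) && (y < z).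
Proof.
have cov := zipper_covers hz.
have /andP[-> _] : covers z x by rewrite cov eqxx.
by have /andP[-> _] : covers z y by rewrite cov eqxx orbT.
Qed.

Lemma zipper_incomp : ~~ (x <= y) && ~~ (y <= x).
Proof.
have cov := zipper_covers hz; have /andP[xz yz] := zipper_lt.
have /and3P[] := zipper_uniq hz; rewrite !inE negb_or => /andP[xy _] _ _.
have /andP[_ /forallP cx] : covers z x by rewrite cov eqxx.
have /andP[_ /forallP cy] : covers z y by rewrite cov eqxx orbT.
apply/andP; split; apply/negP=> le.
  by have := cx y; rewrite yz lt_neqAle xy le.
by have := cy x; rewrite xz lt_neqAle eq_sym xy le.
Qed.

Lemma zipper_ltE w : (w < x) = (w < y).
Proof. by have := zipper_below hz w; rewrite !le0x. Qed.

Lemma zip_neq (u : {v : P | v \notin [:: x; y; z]}) :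
  [/\ val u != x, val u != y & val u != z].
Proof. by have := valP u; rewrite !inE !negb_or => /and3P[]. Qed.

Lemma zip_leE (u : {v : P | v \notin [:: x; y; z]}) :
  (val u <= x) = (val u <= y).
Proof.
have [ux uy _] := zip_neq u.
by rewrite !le_eqVlt (negPf ux) (negPf uy) zipper_ltE.
Qed.

Lemma zip_le_refl : reflexive zip_le.
Proof. by case=> [u|] /=. Qed.

Lemma zip_le_anti : antisymmetric zip_le.
Proof.
have no (u : {v : P | v \notin [:: x; y; z]}) :
    val u <= x -> (x <= val u) || (y <= val u) -> False.
  have [ux uy _] := zip_neq u; move=> lex /orP[ge|ge].
    by move: ux; rewrite eq_le lex ge.
  by move: uy; rewrite eq_le -zip_leE lex ge.
case=> [u|] [v|] //=.
- by move=> /le_anti /val_inj->.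
- by case/andP=> /no.
- by case/andP=> h /no /(_ h).
Qed.

Lemma zip_le_trans : transitive zip_le.
Proof.
case=> [v|] [u|] [w|] //=.
- exact: le_trans.
- exact: le_trans.
- by move=> /orP[] h /(le_trans h) ->; rewrite ?orbT.
- move=> ux /orP[|]; first exact: le_trans.
  by move: ux; rewrite zip_leE; apply: le_trans.
Qed.

HB.instance Definition _ :=
  Order.Le_isPOrder.Build disp P' zip_le_refl zip_le_anti zip_le_trans.

Lemma zip_bot_subproof : \bot \notin [:: x; y; z].
Proof.
have /andP[nxy nyx] := zipper_incomp; have /andP[xz _] := zipper_lt.
rewrite !inE !negb_or; apply/and3P; split; apply/eqP=> e.
- by rewrite -e le0x in nxy.
- by rewrite -e le0x in nyx.
- by rewrite -e ltx0 in xz.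
Qed.

Lemma zip_top_subproof : \top \notin [:: x; y; z].
Proof.
have /andP[xz yz] := zipper_lt.
rewrite !inE !negb_or [_ == z]eq_sym (proper_zipper_top hz) andbT.
by apply/andP; split; apply/eqP=> e; move: xz yz; rewrite -e lt1x.
Qed.

Definition zip_bot : P' := Some (exist _ \bot zip_bot_subproof).
Definition zip_top : P' := Some (exist _ \top zip_top_subproof).

Lemma zip_le0x a : zip_bot <= a.
Proof. by case: a => [u|]; exact: le0x. Qed.

Lemma zip_lex1 a : a <= zip_top.
Proof.
case: a => [u|]; first exact: lex1.
by rewrite /Order.le /= lex1.
Qed.

HB.instance Definition _ := Order.hasBottom.Build disp P' zip_le0x.
HB.instance Definition _ := Order.hasTop.Build disp P' zip_lex1.

End ZippingOrder.

(* Finite abstract simplicial complexes.  The empty face is allowed; it does  *)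
(* not contribute to the geometric realization.                               *)
Record complex (T : finType) := Complex {
  faces :> {set {set T}};
  complex_closed : forall A B : {set T},
    A \subset B -> B \in faces -> A \in faces }.

Definition proper_part (disp : Order.disp_t) (P : finTBPOrderType disp) :
  {set P} := [set~ \bot] :\ \top.

Definition is_chain (disp : Order.disp_t) (P : finPOrderType disp)
  (C : {set P}) : bool := [forall u in C, forall v in C, u >=< v].

Definition chains (disp : Order.disp_t) (P : finPOrderType disp)
  (A : {set P}) : {set {set P}} := [set C : {set P} | C \subset A & is_chain C].

Lemma chains_closed (disp : Order.disp_t) (P : finPOrderType disp)
    (A B C : {set P}) : B \subset C -> C \in chains A -> B \in chains A.
Proof.
move=> /subsetP BC; rewrite !inE => /andP[/subsetP CA /forall_inP ch].
apply/andP; split; first by apply/subsetP => u /BC /CA.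
apply/forall_inP => u /BC /ch /forall_inP ch'.
by apply/forall_inP => v /BC /ch'.
Qed.

Definition order_complex (disp : Order.disp_t) (P : finPOrderType disp)
  (A : {set P}) : complex P := Complex (@chains_closed disp P A).

Definition simplex (d : nat) : complex 'I_d.+1 :=
  @Complex 'I_d.+1 setT (fun A _ _ _ => in_setT A).

Section PL.
Local Open Scope ring_scope.
Variable R : realType.

(* Points of |K| are given by their barycentric coordinates.                  *)
Definition realization (T : finType) (K : complex T) : pred {ffun T -> R} :=
  [pred p : {ffun T -> R} |
    [&& [forall v, 0 <= p v], \sum_v p v == 1 & [set v | p v != 0] \in faces K]].

(* The pair (a, b) encodes the closed half-space of all p with a . p <= b,    *)
(* and a list of such pairs the intersection of these half-spaces.            *)
Definition polyhedron (T : finType) (H : seq ({ffun T -> R} * R)) :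
    pred {ffun T -> R} :=
  [pred p : {ffun T -> R} |
    all (fun h : {ffun T -> R} * R => \sum_v h.1 v * p v <= h.2) H].

(* f : |K| -> |L| is piecewise linear: |K| is a finite union of polyhedra on  *)
(* each of which f is affine.  As the pieces are closed and finitely many,    *)
(* such a map is continuous on |K|.                                           *)
Definition pl_map (T U : finType) (K : complex T) (L : complex U)
    (f : {ffun T -> R} -> {ffun U -> R}) : Prop :=
  {in realization K, forall p, f p \in realization L} /\
  exists pieces : seq (seq ({ffun T -> R} * R)),
    (forall p, (p \in realization K) = has (fun H => p \in polyhedron H) pieces)
    /\ {in pieces, forall H,
         exists (A : U -> T -> R) (b : U -> R),
           {in polyhedron H, forall p u, f p u = \sum_v A u v * p v + b u}}.

Definition pl_homeomorphic (T U : finType) (K : complex T) (L : complex U) :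
    Prop :=
  exists (f : {ffun T -> R} -> {ffun U -> R})
         (g : {ffun U -> R} -> {ffun T -> R}),
    [/\ pl_map K L f, pl_map L K g,
        {in realization K, cancel f g} & {in realization L, cancel g f}].

Definition pl_ball (T : finType) (d : nat) (K : complex T) : Prop :=
  pl_homeomorphic K (simplex d).

End PL.

(* Main.v *)
(* The two order complexes are PL homeomorphic as soon as the zipper is clean. *)
(* Write the elements of [x, 1] as pairs (v, alpha), (v, beta) with v in       *)
(* [x, c], so that x = (x, alpha), z = (x, beta), and set k = (c, alpha).      *)
(* Consider the clique complex of the comparability graph of the proper part.  *)
(* First, z subdivides the edge xy: its link is {x, y} joined with the common  *)
(* part of the links of x and y; so z can be removed and xy made an edge.      *)
(* Next, for x < v < c in increasing order, the edge from x to (v, beta) can   *)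
(* be exchanged for the edge from y to (v, alpha), all four vertices being     *)
(* then joined to the same link.  At the end x subdivides the edge yk and can  *)
(* be removed.  The remaining graph is the comparability graph of the zipped   *)
(* poset, y playing the role of xyz.  Each step is induced by the piecewise    *)
(* linear map moving the mass min(p a1, p a2) from the edge a1 a2 to the edge  *)
(* b1 b2, with inverse of the same form.                                       *)
Require Import Defs.
From mathcomp Require Import all_boot all_order all_algebra.
From mathcomp Require Import reals.
From mathcomp Require Import ring.

Set Implicit Arguments.
Unset Strict Implicit.
Unset Printing Implicit Defensive.

Import Order.TTheory GRing.Theory Num.Theory.

(** * Piecewise linear maps *)

(** Clean zipping preserves the PL homeomorphism type of the order complex
    ([pl_homeomorphic_zipping]), so the result passes to balls by transitivity.

    Everything rests on one local move. If the edge a1 a2 has link {b1, b2} joined with some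
    complex, and b1 b2 is not an edge, its star can be retriangulated across the other diagonal b1
    b2; with a1 = a2 the move instead erases a vertex subdividing b1 b2. [pl_homeomorphic_exchange]
    realizes the move by an explicit map, and [pl_homeomorphic_cliques] reduces its hypotheses, for
    flag complexes, to a comparison of common neighbours.

    On the poset side, [lifting_exists] extracts from cleanness the doubling of [x, c] inside
    [x, 1]. Then [weld_z] erases z, [flips] applies [flip] along a linear extension of [x, c) so
    that everything below v is treated before v, and [weld_x] erases x. The final graph is
    recognized by [zipped_cliques]. *)

Section PLMaps.
Local Open Scope ring_scope.
Variable R : realType.

Lemma polyhedron_cat (T : finType) (H H' : seq ({ffun T -> R} * R)) p :
  (p \in polyhedron (H ++ H')) = (p \in polyhedron H) && (p \in polyhedron H').
Proof. by rewrite !inE all_cat. Qed.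

Definition affine_on (T U : finType) (H : seq ({ffun T -> R} * R))
    (f : {ffun T -> R} -> {ffun U -> R}) : Prop :=
  exists (A : U -> T -> R) (b : U -> R),
    {in polyhedron H, forall p u, f p u = \sum_v A u v * p v + b u}.

(** Substituting q = A p + b into h.1 . q <= h.2: these half-spaces cut out the preimage of the
    polyhedron of [H]. *)
Definition pullback (T U : finType) (A : U -> T -> R) (b : U -> R)
    (H : seq ({ffun U -> R} * R)) : seq ({ffun T -> R} * R) :=
  [seq ([ffun v => \sum_u h.1 u * A u v], h.2 - \sum_u h.1 u * b u)
  | h : {ffun U -> R} * R <- H].

Lemma pullbackP (T U : finType) (A : U -> T -> R) (b : U -> R) H
    (p : {ffun T -> R}) (q : {ffun U -> R}) :
  (forall u, q u = \sum_v A u v * p v + b u) ->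
  (p \in polyhedron (pullback A b H)) = (q \in polyhedron H).
Proof.
move=> qE; rewrite !inE all_map; apply: eq_all => h /=.
rewrite lerBrDr; congr (_ <= _).
rewrite [RHS](eq_bigr (fun u => \sum_v h.1 u * A u v * p v + h.1 u * b u)).
  rewrite big_split exchange_big /=; congr (_ + _).
  by apply: eq_bigr => v _; rewrite ffunE mulr_suml.
by move=> u _; rewrite qE mulrDr mulr_sumr; under eq_bigr do rewrite mulrA.
Qed.

Lemma affine_on_comp (T U W : finType) (H : seq ({ffun T -> R} * R))
    (H' : seq ({ffun U -> R} * R)) (f : {ffun T -> R} -> {ffun U -> R})
    (g : {ffun U -> R} -> {ffun W -> R}) (A : U -> T -> R) (b : U -> R) :
  {in polyhedron H, forall p u, f p u = \sum_v A u v * p v + b u} ->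
  affine_on H' g -> affine_on (H ++ pullback A b H') (g \o f).
Proof.
move=> fE [A' [b' gE]].
exists (fun w v => \sum_u A' w u * A u v), (fun w => \sum_u A' w u * b u + b' w).
move=> p; rewrite polyhedron_cat => /andP[/fE pE].
rewrite (pullbackP _ pE) => /gE gfp w; rewrite /= gfp addrA; congr (_ + _).
rewrite (eq_bigr (fun u => \sum_v A' w u * A u v * p v + A' w u * b u)).
  rewrite big_split exchange_big /=; congr (_ + _).
  by apply: eq_bigr => v _; rewrite mulr_suml.
by move=> u _; rewrite pE mulrDr mulr_sumr; under eq_bigr do rewrite mulrA.
Qed.

(** On a piece of [f] a single affine formula holds, so the preimages of the pieces of [g] are
    polyhedral there; these intersections are the pieces of the composite. *)
Lemma pl_map_comp (T U W : finType) (K : complex T) (L : complex U)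
    (M : complex W) (f : {ffun T -> R} -> {ffun U -> R})
    (g : {ffun U -> R} -> {ffun W -> R}) :
  pl_map K L f -> pl_map L M g -> pl_map K M (g \o f).
Proof.
move=> [fKL [Hs [HsE Hsaff]]] [gLM [Hs' [Hs'E Hs'aff]]].
split=> [p pK|]; first exact/gLM/fKL.
(* Requiring [f p] to lie in |L| makes the claim inductive on the list of pieces of [f]; on |K| the
   requirement is automatic. *)
have [Qs [QsE Qsaff]] : exists Qs : seq (seq ({ffun T -> R} * R)),
    (forall p, has (fun H => p \in polyhedron H) Qs =
       has (fun H => p \in polyhedron H) Hs && (f p \in realization L)) /\
    {in Qs, forall H, affine_on H (g \o f)}.
  elim: Hs Hsaff {HsE} => [_|H Hs IH Hsaff]; first by exists [::].
  have [|Qs [QsE Qsaff]] := IH.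
    by move=> H' H'Hs; apply: Hsaff; rewrite inE H'Hs orbT.
  have [A [b fE]] := Hsaff H (mem_head _ _).
  exists ([seq H ++ pullback A b H' | H' <- Hs'] ++ Qs); split=> [p|Q].
    rewrite has_cat QsE has_map /= andb_orl; congr (_ || _).
    have [pH|pH] /= := boolP (p \in polyhedron H).
      rewrite Hs'E; apply: eq_has => H'.
      by rewrite /= polyhedron_cat pH (pullbackP _ (fE _ pH)).
    by apply/hasPn => H' _; rewrite /= polyhedron_cat (negPf pH).
  rewrite mem_cat => /orP[/mapP[H' /Hs'aff gaff ->]|/Qsaff//].
  exact: affine_on_comp fE gaff.
exists Qs; split=> // p.
by rewrite QsE -HsE andb_idr // => /fKL.
Qed.

Lemma pl_homeomorphic_sym (T U : finType) (K : complex T) (L : complex U) :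
  pl_homeomorphic R K L -> pl_homeomorphic R L K.
Proof. by move=> [f [g []]]; exists g, f. Qed.

Lemma pl_homeomorphic_trans (T U W : finType) (K : complex T) (L : complex U)
    (M : complex W) :
  pl_homeomorphic R K L -> pl_homeomorphic R L M -> pl_homeomorphic R K M.
Proof.
move=> [f [f' [fpl f'pl fK f'K]]] [g [g' [gpl g'pl gK g'K]]].
exists (g \o f), (f' \o g'); split; [exact: pl_map_comp fpl gpl|
  exact: pl_map_comp g'pl f'pl| |].
- by move=> p pK /=; rewrite gK ?fK //; case: fpl => + _; apply.
- by move=> p pM /=; rewrite f'K ?g'K //; case: g'pl => + _; apply.
Qed.

Lemma sum_delta (T : finType) (v : T) (p : T -> R) :
  \sum_u (u == v)%:R * p u = p v.
Proof.
rewrite (bigD1 v) //= eqxx mul1r big1 ?addr0 // => u /negPf->.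
by rewrite mul0r.
Qed.

Definition coord_le0 (T : finType) (a : R) (v : T) : {ffun T -> R} * R :=
  ([ffun u => a * (u == v)%:R], 0).

Lemma coord_le0P (T : finType) (a : R) (s : seq T) p :
  (p \in polyhedron [seq coord_le0 a v | v <- s]) = all (fun v => a * p v <= 0) s.
Proof.
rewrite inE all_map; apply: eq_all => v /=; congr (_ <= _).
by rewrite -(sum_delta v p) mulr_sumr; apply: eq_bigr => u _; rewrite ffunE mulrA.
Qed.

(** The closed simplex on [F]; the first two half-spaces together force the coordinates to sum to
    1. *)
Definition face_cell (T : finType) (F : {set T}) : seq ({ffun T -> R} * R) :=
  [:: ([ffun=> 1], 1); ([ffun=> -1], -1)] ++
  [seq coord_le0 (-1) v | v <- enum T] ++ [seq coord_le0 1 v | v <- enum (~: F)].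

Lemma face_cellP (T : finType) (F : {set T}) p :
  (p \in polyhedron (face_cell F)) =
  [&& [forall v, 0 <= p v], \sum_v p v == 1 & [set v | p v != 0] \subset F].
Proof.
rewrite /face_cell !polyhedron_cat !coord_le0P andbCA.
have -> : all (fun v => -1 * p v <= 0) (enum T) = [forall v, 0 <= p v].
  apply/allP/forallP => [h v|h v _]; last by rewrite mulN1r oppr_le0.
  by have := h v (mem_enum _ _); rewrite mulN1r oppr_le0.
have [/forallP p_ge0|//] := boolP [forall v, 0 <= p v].
rewrite !andTb; congr (_ && _).
  have E a : \sum_v ([ffun=> a] : {ffun T -> R}) v * p v = a * \sum_v p v.
    by rewrite mulr_sumr; apply: eq_bigr => v _; rewrite ffunE.
  by rewrite inE /= andbT !E mul1r mulN1r lerN2 -eq_le.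
apply/allP/subsetP => [h v|h v].
  rewrite inE; apply: contraNT => vF; have := h v.
  by rewrite mem_enum inE vF mul1r eq_le p_ge0 andbT; apply.
rewrite mem_enum inE mul1r => vF; rewrite le_eqVlt; apply/orP; left.
by apply: contraNT vF => pv; apply: h; rewrite inE.
Qed.

(** The pieces in [pl_map] must have union exactly |K|. Intersecting them with the closed simplices
    of [K] ensures this, so a mere cover suffices. *)
Lemma pl_mapI (T U : finType) (K : complex T) (L : complex U)
    (f : {ffun T -> R} -> {ffun U -> R}) (Hs : seq (seq ({ffun T -> R} * R))) :
  {in realization K, forall p, f p \in realization L} ->
  {in realization K, forall p, has (fun H => p \in polyhedron H) Hs} ->
  {in Hs, forall H, affine_on H f} -> pl_map K L f.
Proof.
move=> fKL cover aff; split=> //.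
exists [seq face_cell F ++ H | F <- enum (faces K), H <- Hs]; split=> [p|H].
  apply/idP/hasP => [pK|[Q /allpairsP[[F H] [FK HHs ->]]]]; last first.
    rewrite polyhedron_cat face_cellP => /andP[/and3P[p0 p1 pF] _].
    by rewrite inE p0 p1 (complex_closed pF) // -mem_enum.
  have /hasP[H HHs pH] := cover p pK.
  have /and3P[p0 p1 pF] := pK.
  exists (face_cell [set v | p v != 0] ++ H).
    by apply/allpairsP; exists ([set v | p v != 0], H); split=> //; rewrite mem_enum.
  by rewrite polyhedron_cat face_cellP p0 p1 subxx.
move=> /allpairsP[[F Q] [_ /aff [A [b QE]] ->]].
by exists A, b => p; rewrite polyhedron_cat => /andP[_ /QE].
Qed.

(** * Injective relabelling of vertices *)

Section Relabel.
Variables (T U : finType) (s : T -> U) (K : complex T) (L : complex U).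
Hypothesis s_inj : injective s.
Hypothesis facesE : forall F : {set T}, (F \in faces K) = (s @: F \in faces L).
Hypothesis codomL : forall F, F \in faces L -> F \subset codom s.

(** Masses are pushed forward and pulled back along [s]; by [codomL] no point of |L| has mass off
    the image of [s]. *)
Lemma pl_homeomorphic_relabel : pl_homeomorphic R K L.
Proof.
pose f (p : {ffun T -> R}) : {ffun U -> R} := [ffun u => \sum_(v | s v == u) p v].
pose g (q : {ffun U -> R}) : {ffun T -> R} := [ffun v => q (s v)].
have fs p v : f p (s v) = p v.
  by rewrite ffunE (eq_bigl (pred1 v)) ?big_pred1_eq // => w; rewrite (inj_eq s_inj).
have f0 p u : u \notin codom s -> f p u = 0.
  by move=> us; rewrite ffunE big_pred0 // => v; apply: contraNF us => /eqP<-; exact: codom_f.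
have fK : cancel f g by move=> p; apply/ffunP => v; rewrite ffunE fs.
have gK : {in realization L, cancel g f}.
  move=> q /and3P[_ _ /codomL/subsetP qs]; apply/ffunP => u.
  have [/codomP[v ->]|us] := boolP (u \in codom s); first by rewrite fs ffunE.
  rewrite f0 //; apply/esym/eqP; apply: contraNT us => qu.
  by apply: qs; rewrite inE.
have sum_f p : \sum_u f p u = \sum_v p v.
  rewrite [RHS](partition_big s xpredT) //=.
  by apply: eq_bigr => u _; rewrite ffunE.
have suppf p : [set u | f p u != 0] = s @: [set v | p v != 0].
  apply/setP => u; have [/codomP[v ->]|us] := boolP (u \in codom s).
    by rewrite mem_imset // !inE fs.
  rewrite inE f0 // eqxx; apply/esym/imsetP => -[v _ uv].
  by rewrite uv codom_f in us.
have fKL p : (f p \in realization L) = (p \in realization K).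
  rewrite !inE sum_f suppf -facesE; congr (_ && _).
  apply/forallP/forallP => h v; first by rewrite -fs.
  by rewrite ffunE sumr_ge0.
exists f, g; split=> //; first 1 last.
(* A linear map needs one piece only: the empty list of half-spaces, which is the whole space. *)
- apply: (@pl_mapI _ _ _ _ _ [:: [::]]) => [q qL|//|H].
    by rewrite -fKL gK.
  rewrite inE => /eqP->; exists (fun v u => (u == s v)%:R), (fun=> 0).
  by move=> q _ v; rewrite ffunE addr0 sum_delta.
apply: (@pl_mapI _ _ _ _ _ [:: [::]]) => [p pK|//|H].
  by rewrite fKL.
rewrite inE => /eqP->; exists (fun u v => (s v == u)%:R), (fun=> 0).
move=> p _ u; rewrite ffunE addr0 big_mkcond; apply: eq_bigr => v _.
by case: (s v == u); rewrite ?mul1r ?mul0r.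
Qed.

End Relabel.

Lemma pl_homeomorphic_eq (T : finType) (K L : complex T) :
  faces K =i faces L -> pl_homeomorphic R K L.
Proof.
move=> KL; apply: (@pl_homeomorphic_relabel _ _ id) => // F.
  by rewrite imset_id KL.
by move=> _; apply/subsetP => v _; apply/codomP; exists v.
Qed.

(** * The piecewise linear exchange of two edges *)

Section Exchange.
Variable T : finType.
Implicit Types (a b u v : T) (p : {ffun T -> R}).

(* [mult a1 a2] is the indicator of the multiset {a1, a2}; allowing a1 = a2   *)
(* makes the removal of a vertex an instance of the exchange of edges.        *)
Definition mult a1 a2 u : R := (u == a1)%:R + (u == a2)%:R.

(** The largest t such that t times the multiset {a1, a2} can be removed from [p] leaving
    nonnegative coordinates; it is p a1 / 2 when a1 = a2. *)
Definition level a1 a2 p : R :=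
  Num.min (p a1 / mult a1 a2 a1) (p a2 / mult a1 a2 a2).

Definition exchange a1 a2 b1 b2 p : {ffun T -> R} :=
  [ffun u => p u + level a1 a2 p * (mult b1 b2 u - mult a1 a2 u)].

(** One direction of the move: b1, b2 lie in no common face of [K], faces without the pair a1, a2
    survive, and trading a1, a2 for b1, b2 in a face of [K] gives faces of [L]. *)
Record exchangeable a1 a2 b1 b2 (K L : complex T) : Prop := Exchangeable {
  exch_new : forall F, F \in faces K -> b1 \in F -> b2 \notin F;
  exch_old : forall F, F \in faces K -> ~~ ((a1 \in F) && (a2 \in F)) ->
    F \in faces L;
  exch_cone : forall F : {set T}, b1 \in F -> b2 \in F -> ~~ ((a1 \in F) && (a2 \in F)) ->
    (F :\: [set b1; b2]) :|: [set a1; a2] \in faces K -> F \in faces L }.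

Lemma mult_ge0 a1 a2 u : 0 <= mult a1 a2 u.
Proof. by rewrite addr_ge0. Qed.

Lemma multl_gt0 a1 a2 : 0 < mult a1 a2 a1.
Proof. by rewrite /mult eqxx ltr_wpDr. Qed.

Lemma multr_gt0 a1 a2 : 0 < mult a1 a2 a2.
Proof. by rewrite /mult eqxx ltr_wpDl. Qed.

Lemma mult_eq0 a1 a2 u : (mult a1 a2 u == 0) = (u \notin [set a1; a2]).
Proof.
by rewrite paddr_eq0 // !pnatr_eq0 !eqb0 !inE negb_or.
Qed.

Lemma sum_mult a1 a2 : \sum_u mult a1 a2 u = 2%:R.
Proof.
have E a : \sum_u (u == a)%:R = 1 :> R.
  by rewrite -[RHS](sum_delta a (fun=> 1)); apply: eq_bigr => u _; rewrite mulr1.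
by rewrite /mult big_split /= !E.
Qed.

Lemma mult_disj a1 a2 b1 b2 u : [disjoint [set a1; a2] & [set b1; b2]] ->
  u \in [set a1; a2] -> mult b1 b2 u = 0.
Proof. by move=> dis uA; apply/eqP; rewrite mult_eq0 (disjointFr dis uA). Qed.

Lemma level_le a1 a2 p u : u \in [set a1; a2] ->
  level a1 a2 p * mult a1 a2 u <= p u.
Proof.
rewrite !inE => /orP[]/eqP->.
  by rewrite -ler_pdivlMr ?multl_gt0 // ge_min lexx.
by rewrite -ler_pdivlMr ?multr_gt0 // ge_min lexx orbT.
Qed.

Lemma level_ge0 a1 a2 p : (forall u, 0 <= p u) -> 0 <= level a1 a2 p.
Proof. by move=> p0; rewrite le_min !divr_ge0 ?mult_ge0. Qed.

Lemma level_gt0 a1 a2 p : (forall u, 0 <= p u) ->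
  (0 < level a1 a2 p) = (p a1 != 0) && (p a2 != 0).
Proof.
move=> p0; rewrite lt_min !pmulr_lgt0 ?invr_gt0 ?multl_gt0 ?multr_gt0 //.
by rewrite !lt0r !p0 !andbT.
Qed.

Lemma level_attained a1 a2 p :
  exists2 u, u \in [set a1; a2] & level a1 a2 p * mult a1 a2 u = p u.
Proof.
rewrite /level; case: leP => _; [exists a1|exists a2]; rewrite ?set21 ?set22 //.
  by rewrite divfK // gt_eqF ?multl_gt0.
by rewrite divfK // gt_eqF ?multr_gt0.
Qed.

Lemma exchange_level0 a1 a2 b1 b2 p :
  level a1 a2 p = 0 -> exchange a1 a2 b1 b2 p = p.
Proof. by move=> l0; apply/ffunP => u; rewrite ffunE l0 mul0r addr0. Qed.

Section ExchangeMap.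
Variables (a1 a2 b1 b2 : T) (K L : complex T).
Hypothesis dis : [disjoint [set a1; a2] & [set b1; b2]].
Hypothesis exch : exchangeable a1 a2 b1 b2 K L.
Local Notation f := (exchange a1 a2 b1 b2).

(** A positive level empties a1 or a2 and fills b1 and b2, so [exch_cone] applies to the new
    support; at level 0 the point is fixed and [exch_old] applies. The total mass is kept because
    both multisets have two elements. *)
Lemma exchange_realization :
  {in realization K, forall p, f p \in realization L}.
Proof.
move=> p /and3P[/forallP p0 /eqP p1 pK].
have l_ge0 := level_ge0 a1 a2 p0.
have fp0 u : 0 <= f p u.
  rewrite ffunE; have [uA|uA] := boolP (u \in [set a1; a2]).
    by rewrite (mult_disj dis uA) sub0r mulrN subr_ge0 level_le.
  move: uA; rewrite -mult_eq0 => /eqP->.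
  by rewrite subr0 addr_ge0 ?mulr_ge0 ?mult_ge0.
have fp1 : \sum_u f p u = 1.
  under eq_bigr do rewrite ffunE.
  by rewrite big_split /= p1 -mulr_sumr sumrB !sum_mult subrr mulr0 addr0.
rewrite inE fp1 eqxx; apply/andP; split; first exact/forallP.
rewrite andTb.
move: l_ge0; rewrite le_eqVlt => /orP[/eqP l0|l_gt0].
  rewrite exchange_level0 //; apply: exch_old exch _ pK _.
  by rewrite !inE -level_gt0 // -l0 ltxx.
have := l_gt0; rewrite level_gt0 // => /andP[pa1 pa2].
have pos_b b : b \in [set b1; b2] -> f p b != 0.
  move=> bB; rewrite ffunE gt_eqF // ltr_wpDl //.
  rewrite (@mult_disj b1 b2 a1 a2) ?subr0 1?disjoint_sym //.
  by rewrite mulr_gt0 // lt0r mult_ge0 mult_eq0 bB.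
apply: exch_cone exch _ _ _ _ _.
- by rewrite inE pos_b ?set21.
- by rewrite inE pos_b ?set22.
- rewrite !inE.
  (* The vertex where the minimum is attained loses all its mass. *)
  have [u uA lu] := level_attained a1 a2 p.
  have : f p u = 0 by rewrite ffunE (mult_disj dis uA) sub0r mulrN lu subrr.
  by move: uA; rewrite !inE => /orP[]/eqP-> ->; rewrite eqxx ?andbF.
apply: complex_closed pK; apply/subsetP => u.
rewrite in_setU in_setD => /orP[/andP[]|]; last first.
  by rewrite !inE => /orP[]/eqP->.
rewrite -mult_eq0 => /eqP uB; rewrite !inE ffunE uB sub0r.
apply: contraNneq => pu; rewrite pu add0r.
have [uA|] := boolP (u \in [set a1; a2]).
  by move: uA pa1 pa2; rewrite !inE => /orP[]/eqP<-; rewrite pu eqxx.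
by rewrite -mult_eq0 => /eqP->; rewrite oppr0 mulr0.
Qed.

(** Since b1, b2 share no face of [K], [level b1 b2 p] is 0; the exchange raises it by exactly the
    amount moved, which the reverse exchange returns. *)
Lemma exchangeK : {in realization K, cancel f (exchange b1 b2 a1 a2)}.
Proof.
move=> p /and3P[/forallP p0 _ pK].
have lb : level b1 b2 p = 0.
  apply/eqP; rewrite eq_le level_ge0 // andbT leNgt level_gt0 //.
  apply/negP => /andP[pb1 pb2].
  by have := exch_new exch pK; rewrite !inE pb1 pb2 => /(_ isT).
suff lf : level b1 b2 (f p) = level a1 a2 p.
  by apply/ffunP => u; rewrite ffunE lf ffunE; ring.
have fb b : b \in [set b1; b2] ->
    f p b / mult b1 b2 b = p b / mult b1 b2 b + level a1 a2 p.
  move=> bB; rewrite ffunE (@mult_disj b1 b2 a1 a2) 1?disjoint_sym // subr0.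
  by rewrite mulrDl mulfK // mult_eq0 bB.
by rewrite /level !fb ?set21 ?set22 // -addr_minl -/(level b1 b2 p) lb add0r.
Qed.

(** [level] is the minimum of two linear forms, so the map is affine on each of the two half-spaces
    comparing them. *)
Lemma pl_map_exchange : pl_map K L f.
Proof.
pose n := mult a1 a2.
pose H a a' : seq ({ffun T -> R} * R) :=
  [:: ([ffun u => (u == a)%:R / n a - (u == a')%:R / n a'], 0)].
have HE a a' p : (p \in polyhedron (H a a')) = (p a / n a <= p a' / n a').
  rewrite inE /= andbT -[RHS]subr_le0; congr (_ <= _).
  rewrite -(sum_delta a p) -(sum_delta a' p) !mulr_suml -sumrB.
  by apply: eq_bigr => u _; rewrite ffunE; ring.
have aff a a' : {in polyhedron (H a a'), forall p, level a1 a2 p = p a / n a} ->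
    affine_on (H a a') f.
  move=> lE; pose d u := mult b1 b2 u - mult a1 a2 u.
  exists (fun u v => (v == u)%:R + (v == a)%:R * (d u / n a)), (fun=> 0) => p /lE l u.
  rewrite ffunE l addr0 -/(d u) -{1}(sum_delta u p) -(sum_delta a p) !mulr_suml.
  by rewrite -big_split; apply: eq_bigr => v _ /=; ring.
apply: (@pl_mapI _ _ _ _ _ [:: H a1 a2; H a2 a1]).
- exact: exchange_realization.
- by move=> p _; rewrite /= !HE orbF le_total.
- move=> Q; rewrite !inE => /orP[]/eqP->; apply: aff => p; rewrite HE => h.
    exact/min_idPl.
  exact/min_idPr.
Qed.

End ExchangeMap.

Lemma pl_homeomorphic_exchange a1 a2 b1 b2 (K L : complex T) :
  [disjoint [set a1; a2] & [set b1; b2]] ->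
  exchangeable a1 a2 b1 b2 K L -> exchangeable b1 b2 a1 a2 L K ->
  pl_homeomorphic R K L.
Proof.
move=> dis KL LK; have dis' : [disjoint [set b1; b2] & [set a1; a2]].
  by rewrite disjoint_sym.
exists (exchange a1 a2 b1 b2), (exchange b1 b2 a1 a2).
by split; [exact: pl_map_exchange|exact: pl_map_exchange|
  exact: exchangeK KL|exact: exchangeK LK].
Qed.

End Exchange.

End PLMaps.

(** * Exchanges of edges in clique complexes *)

Section Cliques.
Variable T : finType.
Implicit Types (g : rel T) (F : {set T}).

(* Only the elements [v] with [g v v] are vertices of the clique complex.     *)
Definition cliques g : {set {set T}} :=
  [set F : {set T} | [forall u in F, forall v in F, g u v]].

Lemma cliquesP g F :
  reflect {in F &, forall u v, g u v} (F \in cliques g).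
Proof.
rewrite inE; apply: (iffP forall_inP) => [h u v uF vF|h u uF].
  exact: (forall_inP (h u uF)).
by apply/forall_inP => v; exact: h.
Qed.

Lemma cliques_closed g F F' :
  F \subset F' -> F' \in cliques g -> F \in cliques g.
Proof.
by move=> /subsetP s /cliquesP h; apply/cliquesP => u v /s uF /s vF; exact: h.
Qed.

Definition clique_complex g : complex T := Complex (@cliques_closed g).

(** Faces are tested on pairs, so it suffices to compare edges and common neighbours. The condition
    on [v == a1] and [v == a2] excludes only the erased vertex when a1 = a2. *)
Lemma exchangeable_cliques a1 a2 b1 b2 g g' :
  symmetric g' -> ~~ g b1 b2 ->
  {in [set b1; b2] &, forall u v, g' u v} ->
  (forall u v, ~~ ((a1 \in [set u; v]) && (a2 \in [set u; v])) ->
     ~~ ((b1 \in [set u; v]) && (b2 \in [set u; v])) -> g u v = g' u v) ->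
  (forall v, v \notin [set b1; b2] -> ~~ ((v == a1) && (v == a2)) ->
     g v a1 -> g v a2 -> g' v b1 && g' v b2) ->
  exchangeable a1 a2 b1 b2 (clique_complex g) (clique_complex g').
Proof.
move=> sym ngb gb gg' link.
have pairP a a' u v (F : {set T}) : u \in F -> v \in F -> ~~ ((a \in F) && (a' \in F)) ->
    ~~ ((a \in [set u; v]) && (a' \in [set u; v])).
  move=> uF vF; apply: contra; rewrite !inE => /andP[auv a'uv].
  by apply/andP; split; [case/orP: auv|case/orP: a'uv] => /eqP->.
split=> F.
- move=> /cliquesP gF b1F; apply: contra ngb; exact: gF.
- move=> /cliquesP gF FA; apply/cliquesP => u v uF vF.
  rewrite -gg' ?gF ?(pairP _ _ _ _ _ uF vF) //.
  by apply: contra ngb => /andP[/gF h /h].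
move=> b1F b2F FA /cliquesP gF.
(* Such a [u] lies in a clique of [g] with a1 and a2, so [link] joins it to both b1 and b2. *)
have cone u v : u \notin [set b1; b2] -> u \in F -> v \in [set b1; b2] -> g' u v.
  move=> uB uF vB.
  have /andP[gb1 gb2] : g' u b1 && g' u b2.
    apply: link => //.
    - by apply: contra FA => /andP[/eqP<- /eqP<-]; rewrite uF.
    - by apply: gF; rewrite in_setU ?set21 ?orbT // in_setD uB uF.
    - by apply: gF; rewrite in_setU ?set22 ?orbT // in_setD uB uF.
  by move: vB; rewrite !inE => /orP[]/eqP->.
apply/cliquesP => u v uF vF.
have [uB|uB] := boolP (u \in [set b1; b2]); have [vB|vB] := boolP (v \in [set b1; b2]).
- exact: gb.
- by rewrite sym cone.
- exact: cone.
rewrite -gg'; first by rewrite gF // in_setU in_setD ?uB ?vB ?uF ?vF.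
  exact: pairP FA.
apply: contra uB => /andP[]; rewrite !inE => /orP[/eqP<-|/eqP b1v]; first by rewrite eqxx.
by move: vB; rewrite !inE b1v eqxx.
Qed.

End Cliques.

Lemma pl_homeomorphic_cliques (R : realType) (T : finType) (a1 a2 b1 b2 : T)
    (g g' : rel T) :
  symmetric g -> symmetric g' -> [disjoint [set a1; a2] & [set b1; b2]] ->
  ~~ g b1 b2 -> ~~ g' a1 a2 ->
  {in [set a1; a2] &, forall u v, g u v} ->
  {in [set b1; b2] &, forall u v, g' u v} ->
  (forall u v, ~~ ((a1 \in [set u; v]) && (a2 \in [set u; v])) ->
     ~~ ((b1 \in [set u; v]) && (b2 \in [set u; v])) -> g u v = g' u v) ->
  (forall v, v \notin [set b1; b2] -> ~~ ((v == a1) && (v == a2)) ->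
     g v a1 -> g v a2 -> g' v b1 && g' v b2) ->
  (forall v, v \notin [set a1; a2] -> ~~ ((v == b1) && (v == b2)) ->
     g' v b1 -> g' v b2 -> g v a1 && g v a2) ->
  pl_homeomorphic R (clique_complex g) (clique_complex g').
Proof.
move=> sym sym' dis ngb nga gA gB gg' link link'.
apply: (pl_homeomorphic_exchange R dis); first exact: exchangeable_cliques.
by apply: exchangeable_cliques => // u v uB uA; rewrite gg'.
Qed.

(** * From the poset to its zipping *)

Local Open Scope order_scope.

(** * The doubling of [x, c] given by cleanness *)

Section Lift.
Variables (disp : Order.disp_t) (P : finTBPOrderType disp) (x y z : P).

(* In terms of an isomorphism of [x, 1] with [x, c] * 2 taking z to (x, beta), *)
(* these are the elements of [x, c] * {alpha}.                                *)
Definition lower : {set P} := [set u | (x <= u) && ~~ (z <= u)].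

(* [lift] is (v, alpha) |-> (v, beta) and [k] is (c, alpha).                  *)
Record lifting (lift : P -> P) (k : P) : Prop := Lifting {
  lift_mono : {in lower &, {mono lift : u v / u <= v}};
  lift_leE : {in lower, forall u w, z <= w -> (lift u <= w) = (u <= w)};
  lift_surj : forall w, z <= w -> exists2 u, u \in lower & lift u = w;
  lift_bottom : lift x = z;
  lift_max : lift k = \top;
  mem_max : k \in lower;
  lower_max : {in lower, forall u, u <= k} }.

(** Since [phi z] is (x, true), an element u above x is above z exactly when [phi u] has second
    coordinate true; all fields are then read off in coordinates. *)
Lemma lifting_exists : clean_zipper x y z -> exists lift k, lifting lift k.
Proof.
move=> [[hz ztop] [c [phi [_ [phiB phi_mono phi_surj] phiz]]]].
have xz : x <= z.
  by apply: ltW; have /andP[] : covers z x by rewrite (zipper_covers hz) eqxx.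
have phi_le u v : x <= u -> x <= v -> (phi u <= phi v) = (u <= v).
  by move=> xu xv; apply: phi_mono; rewrite !inE ?xu ?xv lex1.
have phi1 u : x <= u -> x <= (phi u).1 <= c.
  by move=> xu; apply: phiB; rewrite !inE xu lex1.
have inv w : x <= w.1 <= c -> exists2 u, x <= u & phi u = w.
  by move=> /phi_surj[u]; rewrite inE => /andP[xu _] <-; exists u.
have lowerP u : x <= u -> (z <= u) = (phi u).2.
  move=> xu; rewrite -phi_le // phiz leEprod /=.
  by have /andP[-> _] := phi1 u xu; case: (phi u).2.
have phi_lower u : (u \in lower) = (x <= u) && ~~ (phi u).2.
  by rewrite inE; case xu: (x <= u) => //=; rewrite lowerP.
(* The default is reached only outside [x, 1]. *)
pose lift u := odflt u [pick v | (x <= v) && (phi v == ((phi u).1, true))].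
have liftP u : x <= u -> x <= lift u /\ phi (lift u) = ((phi u).1, true).
  move=> xu; rewrite /lift; case: pickP => [v /andP[xv /eqP //]|no].
  have [v xv phiv] := inv ((phi u).1, true) (phi1 u xu).
  by have := no v; rewrite xv phiv eqxx.
have xc : x <= c by have /andP[h /(le_trans h)] := phi1 x (lexx x).
have [k xk phik] : exists2 u, x <= u & phi u = (c, false).
  by apply: inv; rewrite /= xc lexx.
have phi_inj u v : x <= u -> x <= v -> phi u = phi v -> u = v.
  by move=> xu xv uv; apply/le_anti; rewrite -(phi_le u v) // -(phi_le v u) // uv !lexx.
have phi_top u : x <= u -> phi u <= (c, true).
  by move=> /phi1/andP[_ uc]; rewrite leEprod /= uc; case: (phi u).2.
have lx u : u \in lower -> x <= u by rewrite inE => /andP[].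
exists lift, k; split.
- move=> u v; rewrite !phi_lower => /andP[xu nu] /andP[xv nv].
  have [xlu phlu] := liftP u xu; have [xlv phlv] := liftP v xv.
  rewrite -[RHS]phi_le // -phi_le // phlu phlv !leEprod /= andbT.
  by case: (phi u).2 nu => // _; case: (phi v).2; rewrite !andbT.
- move=> u ul w zw; have xu := lx u ul; have [xlu phlu] := liftP u xu.
  have xw := le_trans xz zw; rewrite -[RHS]phi_le // -phi_le // phlu !leEprod /=.
  by have := lowerP w xw; rewrite zw => <-; case: (phi u).2.
- move=> w zw; have xw := le_trans xz zw.
  have [u xu phu] := inv ((phi w).1, false) (phi1 w xw).
  have ul : u \in lower by rewrite phi_lower xu phu.
  exists u => //; have [xlu phlu] := liftP u xu.
  apply: phi_inj => //; rewrite phlu phu /= [RHS]surjective_pairing.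
  by rewrite -lowerP // zw.
(* The first coordinate of [phi x] is at least x, and at most that of [phi z], which is x. *)
- have [xlx phlx] := liftP x (lexx x); apply: phi_inj => //; rewrite phlx phiz.
  congr (_, _); apply/le_anti; have /andP[-> _] := phi1 x (lexx x).
  by have := xz; rewrite -phi_le // phiz leEprod andbT => /andP[].
- have [xlk phlk] := liftP k xk; apply/le_anti; rewrite lex1 /=.
  by rewrite -phi_le ?lex1 // phlk phik phi_top ?lex1.
- by rewrite phi_lower xk phik.
move=> u ul; have xu := lx u ul; rewrite -phi_le // phik leEprod /=.
by have /andP[_ ->] := phi1 u xu; move: ul; rewrite phi_lower => /andP[_]; case: (phi u).2.
Qed.
End Lift.

(** * Order relations around the zipper and the graphs between the two posets *)

Section Moves.
Variables (R : realType) (disp : Order.disp_t) (P : finTBPOrderType disp).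
Variables (x y z : P) (hz : proper_zipper x y z).
Variables (lift : P -> P) (k : P) (hl : lifting x z lift k).
Local Notation lower := (lower x z).
Local Notation pp := (proper_part P).
Implicit Types (u v w : P) (V I : {set P}).

Let xz : x < z. Proof. by have /andP[] := zipper_lt hz. Qed.
Let yz : y < z. Proof. by have /andP[] := zipper_lt hz. Qed.
Let nxy : (x <= y) = false. Proof. by have /andP[/negPf] := zipper_incomp hz. Qed.
Let nyx : (y <= x) = false. Proof. by have /andP[_ /negPf] := zipper_incomp hz. Qed.
Let neq_xy : (x == y) = false. Proof. by apply: contraFF nxy => /eqP->. Qed.
Let neq_yx : (y == x) = false. Proof. by rewrite eq_sym. Qed.

Lemma mem_proper u : (u \in pp) = (u != \top) && (u != \bot).
Proof. by rewrite !inE. Qed.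

(** A maximal element of [w, z) is covered by z, hence is x or y. Maximizing the size of the
    principal ideal produces one. *)
Lemma lt_zipper w : w < z -> (w <= x) || (w <= y).
Proof.
move=> wz; pose Q := [pred v | (w <= v) && (v < z)].
have Qw : Q w by rewrite /= lexx.
have [v /andP[wv vz] vmax] := @arg_maxnP _ w Q (fun v => #|[set t | t <= v]|) Qw.
suff : covers z v by rewrite (zipper_covers hz) => /orP[]/eqP<-; rewrite wv ?orbT.
rewrite /covers vz; apply/forallP => t; apply/negP => /andP[vt tz].
have := vmax t; rewrite /= tz (le_trans wv (ltW vt)) => /(_ isT).
apply/negP; rewrite -ltnNge; apply: proper_card; apply/properP; split.
  by apply/subsetP => s; rewrite !inE => /le_trans; apply; exact: ltW.
by exists t; rewrite !inE // lt_geF.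
Qed.

Lemma lt_zipper_below w : w < z -> w != x -> w != y -> (w < x) && (w < y).
Proof.
move=> /lt_zipper + wx wy; rewrite !le_eqVlt (negPf wx) (negPf wy) /=.
by rewrite -(zipper_ltE hz) orbb andbb.
Qed.

Lemma mem_lower u : (u \in lower) = (x <= u) && ~~ (z <= u).
Proof. by rewrite inE. Qed.

Lemma x_lower : x \in lower.
Proof. by rewrite mem_lower lexx lt_geF. Qed.

Lemma lower_ge u : u \in lower -> x <= u.
Proof. by rewrite mem_lower => /andP[]. Qed.

Lemma lower_nge u : u \in lower -> (z <= u) = false.
Proof. by rewrite mem_lower => /andP[_ /negPf]. Qed.

Lemma lower_ngey u : u \in lower -> (y <= u) = false.
Proof.
by move=> ul; have := zipper_join hz u; rewrite lower_nge // lower_ge.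
Qed.

Lemma lower_nley u : u \in lower -> (u <= y) = false.
Proof. by move=> /lower_ge xu; apply: contraFF nxy; exact: le_trans. Qed.

Lemma lower_neqy u : u \in lower -> (u == y) = false.
Proof. by move=> ul; apply: contraFF (lower_ngey ul) => /eqP->. Qed.

Lemma lift_ge u : u \in lower -> z <= lift u.
Proof.
by move=> ul; rewrite -(lift_bottom hl) (lift_mono hl) ?lower_ge ?x_lower.
Qed.

Lemma le_lift u : u \in lower -> u <= lift u.
Proof. by move=> ul; rewrite -(lift_leE hl) ?lift_ge. Qed.

Lemma lift_inj : {in lower &, injective lift}.
Proof.
move=> u v ul vl uv; apply/le_anti.
by rewrite -(lift_mono hl) // uv lexx -(lift_mono hl) // uv lexx.
Qed.

Lemma mem_lift I u : I \subset lower -> u \in lower ->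
  (lift u \in lift @: I) = (u \in I).
Proof.
move=> /subsetP Il ul; apply/imsetP/idP => [[v vI /lift_inj]|uI]; last by exists u.
by move=> /(_ ul (Il v vI)) ->.
Qed.

Lemma notin_lift I u : I \subset lower -> ~~ (z <= u) -> u \notin lift @: I.
Proof.
move=> /subsetP Il; apply: contraNN => /imsetP[v /Il vl ->]; exact: lift_ge.
Qed.

Lemma lower_proper u : u \in lower -> u \in pp.
Proof.
move=> ul; rewrite mem_proper; apply/andP; split.
  by apply: contraFN (lower_nge ul) => /eqP->; rewrite lex1.
apply: contraFN nxy => /eqP u0; have := lower_ge ul.
by rewrite u0 lex0 => /eqP->; rewrite le0x.
Qed.

Lemma lift_eq_top u : u \in lower -> (lift u == \top) = (u == k).
Proof.
move=> ul; rewrite -(lift_max hl); apply/eqP/eqP => [|-> //].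
by apply: lift_inj => //; exact: mem_max hl.
Qed.

Lemma lift_eq_z u : u \in lower -> (lift u == z) = (u == x).
Proof.
move=> ul; rewrite -(lift_bottom hl); apply/eqP/eqP => [|-> //].
by apply: lift_inj => //; exact: x_lower.
Qed.

Lemma z_proper : z \in pp.
Proof.
rewrite mem_proper (proper_zipper_top hz) /=.
by apply: contraTneq xz => ->; rewrite ltx0.
Qed.

Lemma y_proper : y \in pp.
Proof.
rewrite mem_proper; apply/andP; split; last by apply: contraFneq nyx => ->; rewrite le0x.
by apply: contraFneq nxy => ->; rewrite lex1.
Qed.

Lemma k_neq_x : k != x.
Proof.
by rewrite eq_sym -lift_eq_top ?x_lower // (lift_bottom hl) (proper_zipper_top hz).
Qed.

(* The graphs interpolating between the comparability graphs of the two proper *)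
(* parts: for [w] in [I], the edge from [x] to [lift w] has been exchanged for *)
(* the edge from [y] to [w].                                                  *)
Definition cut I u v := (u == x) && (v \in lift @: I).
Definition added I u v := (u == y) && (v \in I).
Definition adj V I : rel P := fun u v =>
  [&& u \in V, v \in V
    & [|| (u >=< v) && ~~ (cut I u v || cut I v u), added I u v | added I v u]].

Lemma adj_sym V I : symmetric (adj V I).
Proof.
by move=> u v; rewrite /adj andbCA comparable_sym (orbC (cut _ _ _)) (orbC (added _ _ _)).
Qed.

Section Adj.
Variables V I : {set P}.
Hypothesis Il : I \subset lower.

Lemma adj_xE u : u != y ->
  adj V I x u = [&& x \in V, u \in V, x >=< u & u \notin lift @: I].
Proof.
move=> uy; rewrite /adj /cut /added eqxx neq_xy (negPf uy) !orbF andTb.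
by rewrite (negPf (@notin_lift _ x Il _)) ?lt_geF // andbF orbF.
Qed.

Lemma adj_xy : adj V I x y = [&& x \in V, y \in V & x \in I].
Proof.
by rewrite /adj /added eqxx neq_xy /= /Order.comparable nxy nyx.
Qed.

Lemma adj_yE u : u != x ->
  adj V I y u = [&& y \in V, u \in V & (y >=< u) || (u \in I)].
Proof.
move=> ux; rewrite /adj /cut /added eqxx neq_yx (negPf ux) /= andbT.
have -> : (y \in I) = false by apply/negP => /(subsetP Il)/lower_neqy; rewrite eqxx.
by rewrite andbF orbF.
Qed.

Lemma adjE u v : u != x -> v != x -> u != y -> v != y ->
  adj V I u v = [&& u \in V, v \in V & u >=< v].
Proof.
move=> ux vx uy vy.
by rewrite /adj /cut /added (negPf ux) (negPf vx) (negPf uy) (negPf vy) andbT !orbF.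
Qed.

Lemma adj_refl u : adj V I u u = (u \in V).
Proof.
have [->|uy] := eqVneq u y; first by rewrite adj_yE ?neq_yx // comparablexx andbT andbb.
have [->|ux] := eqVneq u x; last by rewrite adjE // comparablexx andbT andbb.
by rewrite adj_xE ?neq_xy // comparablexx notin_lift ?lt_geF // !andbT andbb.
Qed.

End Adj.

(** The graphs are symmetric and reflexive on their vertices, so each clique condition on a pair
    reduces to one edge. *)
Lemma exchange_step V V' I I' (a1 a2 b1 b2 : P) :
  I \subset lower -> I' \subset lower ->
  [disjoint [set a1; a2] & [set b1; b2]] ->
  ~~ adj V I b1 b2 -> ~~ adj V' I' a1 a2 ->
  [&& a1 \in V, a2 \in V & adj V I a1 a2] ->
  [&& b1 \in V', b2 \in V' & adj V' I' b1 b2] ->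
  (forall u v, ~~ ((a1 \in [set u; v]) && (a2 \in [set u; v])) ->
     ~~ ((b1 \in [set u; v]) && (b2 \in [set u; v])) ->
     adj V I u v = adj V' I' u v) ->
  (forall v, v \notin [set b1; b2] -> ~~ ((v == a1) && (v == a2)) ->
     adj V I v a1 -> adj V I v a2 -> adj V' I' v b1 && adj V' I' v b2) ->
  (forall v, v \notin [set a1; a2] -> ~~ ((v == b1) && (v == b2)) ->
     adj V' I' v b1 -> adj V' I' v b2 -> adj V I v a1 && adj V I v a2) ->
  pl_homeomorphic R (clique_complex (adj V I)) (clique_complex (adj V' I')).
Proof.
move=> Il I'l dis nb na /and3P[a1V a2V a12] /and3P[b1V b2V b12] agree.
apply: pl_homeomorphic_cliques => //; [exact: adj_sym|exact: adj_sym| |].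
  by move=> u v; rewrite !inE => /orP[]/eqP-> /orP[]/eqP->;
    rewrite ?adj_refl // adj_sym.
by move=> u v; rewrite !inE => /orP[]/eqP-> /orP[]/eqP->;
  rewrite ?adj_refl // adj_sym.
Qed.

(** * The moves: erasing z, flipping edges, erasing x *)

Local Notation V1 := (pp :\ z).
Local Notation V2 := (pp :\ z :\ x).

Lemma mem_V1 u : u \in lower -> u \in V1.
Proof.
move=> ul; rewrite in_setD1 lower_proper // andbT.
by apply: contraFN (lower_nge ul) => /eqP->.
Qed.

Lemma y_V1 : y \in V1.
Proof. by rewrite in_setD1 y_proper lt_eqF. Qed.

(** Elements below z other than x, y are below both, and elements above z are above both;
    conversely, an element comparable with x and y is below z or above their join z. Thus z is the
    midpoint of x y, the edge added for I = {x}. *)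
Lemma weld_z :
  pl_homeomorphic R (clique_complex (adj pp set0)) (clique_complex (adj V1 [set x])).
Proof.
have xl := x_lower; have zx : z != x by rewrite gt_eqF.
have zy : z != y by rewrite gt_eqF.
have xyn : x != y by rewrite neq_xy. have yxn : y != x by rewrite neq_yx.
have sx : [set x] \subset lower by rewrite sub1set.
have s0 : set0 \subset lower by exact: sub0set.
have xV : x \in V1 := mem_V1 xl.
have yV := y_V1.
have imx : lift @: [set x] = [set z] by rewrite imset_set1 (lift_bottom hl).
apply: (@exchange_step _ _ _ _ z z x y) => //.
- by rewrite disjoint_sym disjoints_subset; apply/subsetP=> u; rewrite !inE => /orP[]/eqP->;
    rewrite orbb eq_sym.
- by rewrite adj_xy // in_set0 !andbF.
- by rewrite adj_refl // !inE eqxx.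
- by rewrite adj_refl // z_proper.
- by rewrite adj_xy // xV yV set11.
- move=> u v; rewrite !inE !andbb negb_or ![z == _]eq_sym => /andP[uz vz] nxyuv.
  rewrite /adj !in_setD1 uz vz /cut /added !in_set0 imx imset0 !inE (negPf uz) (negPf vz) !andbF.
  congr [&& _, _ & _]; rewrite !orbF andbT; case: (u >=< v) => //=.
  apply/esym/negbTE; apply: contra nxyuv.
  by case/orP=> /andP[/eqP-> /eqP->]; rewrite !eqxx ?orbT.
- move=> u; rewrite !inE negb_or andbb => /andP[ux uy] uz.
  rewrite adjE // => /and3P[uV _ uz'] _.
  have uV1 : u \in V1 by rewrite in_setD1 uz.
  rewrite adj_sym adj_xE // adj_sym adj_yE // xV yV uV1 imx in_set1 uz /=.
  move: uz'; rewrite /Order.comparable !le_eqVlt (negPf uz) [z == u]eq_sym (negPf uz) /=.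
  case/orP=> [uz'|zu].
    by have /andP[-> ->] := lt_zipper_below uz' ux uy; rewrite !orbT.
  by rewrite (lt_trans xz zu) (lt_trans yz zu) !orbT.
move=> u; rewrite !inE orbb => uz _ ux uy; rewrite andbb.
have [uX|neux] := eqVneq u x.
  by rewrite uX adj_xE // lower_proper // z_proper imset0 in_set0 /Order.comparable (ltW xz).
have [uY|neuy] := eqVneq u y.
  by rewrite uY adj_yE // y_proper z_proper /Order.comparable (ltW yz).
move: ux; rewrite adj_sym adj_xE // => /and4P[_ uV xu _].
move: uy; rewrite adj_sym adj_yE // in_set1 (negPf neux) orbF => /and3P[_ _ yu].
move: uV; rewrite in_setD1 => /andP[_ uV]; rewrite adjE // uV z_proper /=.
move: xu yu; rewrite /Order.comparable => /orP[xu|ux]; last by rewrite (le_trans ux (ltW xz)).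
by case/orP=> [yu|uy]; rewrite ?(zipper_join hz) ?xu ?yu ?orbT // (le_trans uy (ltW yz)).
Qed.

Lemma flip I v : I \subset lower -> x \in I -> v \in lower -> v \notin I ->
  v != k -> {in lower, forall u, u < v -> u \in I} ->
  {in I, forall u, ~~ (v <= u)} ->
  pl_homeomorphic R (clique_complex (adj V1 I)) (clique_complex (adj V1 (v |: I))).
Proof.
move=> Il xI vl vI vk below above.
have xv : x != v by apply: contraNneq vI => <-.
have vx : v != x by rewrite eq_sym.
have vI'l : v |: I \subset lower by rewrite subUset sub1set vl.
have vy : v != y by rewrite lower_neqy.
have lvV : lift v \in V1.
  rewrite in_setD1 lift_eq_z // vx mem_proper lift_eq_top // vk /=.
  by apply: contraTneq (lt_le_trans xz (lift_ge vl)) => ->; rewrite ltx0.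
have nz_neq u : z <= u -> [/\ u != x, u != y & u != v].
  move=> zu; split; first by rewrite gt_eqF // (lt_le_trans xz).
    by rewrite gt_eqF // (lt_le_trans yz).
  by apply: contraTneq zu => ->; rewrite lower_nge.
have [lx ly lv] := nz_neq _ (lift_ge vl).
have yx : y != x by rewrite neq_yx.
have vV := mem_V1 vl; have xV := mem_V1 x_lower; have yV := y_V1.
have nvl := notin_lift Il (negbT (lower_nge vl)).
have nvl' := notin_lift vI'l (negbT (lower_nge vl)).
have xv_le := lower_ge vl; have vlv := le_lift vl.
have ylv : y <= lift v by rewrite (le_trans (ltW yz)) // lift_ge.
apply: (@exchange_step _ _ _ _ x (lift v) y v) => //.
- by rewrite disjoints_subset; apply/subsetP => u;
    rewrite !inE => /orP[]/eqP->; rewrite negb_or ?lx ?ly ?lv ?neq_xy.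
- by rewrite adj_yE // (negPf vI) /Order.comparable lower_ngey // lower_nley // !andbF.
- by rewrite adj_xE // mem_lift // setU11 !andbF.
- by rewrite xV lvV adj_xE // xV lvV mem_lift // vI /Order.comparable (le_trans xv_le vlv).
- by rewrite yV vV adj_yE // yV vV setU11 orbT.
- move=> u w nx ny.
  have cutE s t : ~~ ((x \in [set s; t]) && (lift v \in [set s; t])) ->
      cut (v |: I) s t = cut I s t.
    rewrite /cut imsetU1 (in_setU1 t (lift v)); have [->|] := eqVneq s x => //.
    by have [->|] := eqVneq t (lift v); rewrite ?set21 ?set22.
  have addedE s t : ~~ ((y \in [set s; t]) && (v \in [set s; t])) ->
      added (v |: I) s t = added I s t.
    rewrite /added (in_setU1 t v); have [->|] := eqVneq s y => //.
    by have [->|] := eqVneq t v; rewrite ?set21 ?set22.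
  by rewrite /adj !cutE ?addedE // setUC.
- move=> u; rewrite !inE negb_or => /andP[uy uv] _.
  have [->|ux] := eqVneq u x.
    by move=> _ _; rewrite adj_xy // setU1r // adj_xE // xV yV vV nvl' /Order.comparable xv_le.
  rewrite adj_sym adj_xE // => /and4P[_ uV xu nul]; rewrite adjE // => /and3P[_ _ ulv].
  rewrite adj_sym adj_yE // adjE // yV uV vV /= in_setU1 (negPf uv) /=.
  case/orP: xu => [xu|lux]; last first.
    have : u < x by rewrite lt_neqAle ux.
    rewrite (zipper_ltE hz) => /ltW uy'; rewrite /Order.comparable uy' orbT /=.
    by rewrite (le_trans lux xv_le).
  have [zu|zu] := boolP (z <= u).
    have [w wl uw] := lift_surj hl zu; subst u.
    have yu : y <= lift w by rewrite (le_trans (ltW yz)).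
    rewrite /Order.comparable yu /=.
    (* The edge from x to [lift w] is still uncut, so w < v would contradict [below]. *)
    have wI : w \notin I by move: nul; rewrite mem_lift.
    case/orP: ulv; rewrite (lift_mono hl) // => wv.
      have [ewv|nwv] := eqVneq w v; first by rewrite ewv vlv orbT.
      by case/negP: wI; apply: below => //; rewrite lt_neqAle nwv.
    by rewrite (le_trans vlv) ?(lift_mono hl) // orbT.
  have ul : u \in lower by rewrite mem_lower xu.
  have uv' : u <= v.
    case/orP: ulv => [|lvu]; first by rewrite -(lift_leE hl) ?lift_ge // (lift_mono hl).
    by case/negP: zu; apply: le_trans lvu; rewrite lift_ge.
  (* The edge from y to u was added by an earlier flip, as u < v. *)
  by rewrite (below u ul) ?lt_neqAle ?uv // /Order.comparable uv' orbT.
move=> u; rewrite !inE negb_or => /andP[ux ulv] _.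
have [->|uy] := eqVneq u y.
  by move=> _ _; rewrite adj_sym adj_xy // xV yV xI adj_yE // yV lvV /Order.comparable ylv.
rewrite adj_sym adj_yE // => /and3P[_ uV yu].
have [->|uv] := eqVneq u v.
  by move=> _; rewrite adj_sym adj_xE // adjE // xV vV lvV nvl /Order.comparable xv_le vlv.
rewrite adjE // => /and3P[_ _ uv'].
rewrite adj_sym adj_xE // adjE // xV uV lvV /=.
move: yu; rewrite in_setU1 (negPf uv) /= => /orP[|uI]; last first.
  have ul := subsetP Il u uI.
  rewrite notin_lift ?lower_nge // /Order.comparable lower_ge //=.
  have uv2 : u <= v by move: uv'; rewrite /Order.comparable (negPf (above u uI)) orbF.
  by rewrite (le_trans uv2 vlv).
case/orP=> [yu|luy]; last first.
  have : u < y by rewrite lt_neqAle uy.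
  rewrite -(zipper_ltE hz) => /ltW lux.
  have luv := le_trans lux xv_le; rewrite /Order.comparable lux orbT (le_trans luv vlv) andbT /=.
  apply: notin_lift => //; apply: contraTN lux => zu; rewrite lt_geF //.
  exact: lt_le_trans zu.
have vu : v <= u.
  case/orP: uv' => // luv; have := lower_ngey vl; by rewrite (le_trans yu luv).
(* Above y and v, hence above x and y, so above their join. *)
have zu : z <= u by rewrite (zipper_join hz) yu (le_trans xv_le vu).
have [w wl uw] := lift_surj hl zu; subst u.
have lvu : lift v <= lift w by rewrite (lift_leE hl).
rewrite /Order.comparable (le_trans xv_le vu) lvu orbT andbT /=.
by rewrite mem_lift //; apply/negP => /above/negP; rewrite -(lift_mono hl).
Qed.

Lemma k_V1 : k \in V1.
Proof. by rewrite mem_V1 // (mem_max hl). Qed.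

(** All edges from x to proper elements above z are now cut. What remains near x, apart from y and
    k, is below x or in [lower], hence adjacent to both y and k: x is the midpoint of y k. *)
Lemma weld_x :
  pl_homeomorphic R (clique_complex (adj V1 (lower :\ k))) (clique_complex (adj V2 lower)).
Proof.
have kl := mem_max hl; have kx := k_neq_x; have xl := x_lower.
have Il : lower :\ k \subset lower by exact: subsetDl.
have kV := k_V1; have yV := y_V1; have xV := mem_V1 xl.
have yx : y != x by rewrite neq_yx.
have kV2 : k \in V2 by rewrite in_setD1 kx.
have yV2 : y \in V2 by rewrite in_setD1 yx.
have ky : k != y by rewrite lower_neqy.
have xk := lower_ge kl.
have xI : x \in lower :\ k by rewrite in_setD1 eq_sym kx.
have nkl := notin_lift Il (negbT (lower_nge kl)).
apply: (@exchange_step _ _ _ _ x x y k) => //.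
- rewrite disjoint_sym disjoints_subset; apply/subsetP=> u.
  by rewrite !inE => /orP[]/eqP->; rewrite orbb.
- by rewrite adj_yE // setD11 /Order.comparable lower_ngey // lower_nley // !andbF.
- by rewrite adj_refl // !inE eqxx.
- by rewrite adj_refl // xV.
- by rewrite yV2 kV2 adj_yE // yV2 kV2 kl orbT.
- move=> u w xuw ny; move: xuw; rewrite !inE !andbb negb_or ![x == _]eq_sym => /andP[ux wx].
  have addedE s t : ~~ ((y \in [set s; t]) && (k \in [set s; t])) ->
      added (lower :\ k) s t = added lower s t.
    rewrite /added (in_setD1 t); have [->|] := eqVneq s y => //.
    by have [->|] := eqVneq t k; rewrite ?set21 ?set22.
  rewrite /adj (addedE u w) // (addedE w u); last by rewrite setUC.
  by rewrite ![_ \in V2]in_setD1 ux wx /cut (negPf ux) (negPf wx).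
- move=> u; rewrite !inE negb_or andbb => /andP[uy uk] ux.
  rewrite adj_sym adj_xE // => /and4P[_ uV xu nul] _.
  have uV2 : u \in V2 by rewrite in_setD1 ux.
  rewrite adj_sym adj_yE // adjE // yV2 uV2 kV2 /=.
  case/orP: xu => [xu|lux]; last first.
    have : u < x by rewrite lt_neqAle ux.
    rewrite (zipper_ltE hz) => /ltW uy'; rewrite /Order.comparable uy' orbT /=.
    by rewrite (le_trans lux xk).
  have [zu|zu] := boolP (z <= u).
    (* An uncut u above z could only be [lift k], which is the top and not proper. *)
    have [w wl uw] := lift_surj hl zu; subst u.
    move: nul; rewrite mem_lift // in_setD1 wl andbT negbK => /eqP wk.
    by move: uV; rewrite in_setD1 mem_proper lift_eq_top // wk eqxx /= andbF.
  have ul : u \in lower by rewrite mem_lower xu.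
  by rewrite ul orbT /= /Order.comparable (lower_max hl).
move=> u; rewrite !inE orbb => ux _; rewrite andbb.
have [->|uy] := eqVneq u y; first by move=> _ _; rewrite adj_sym adj_xy // xV yV xI.
rewrite adj_sym adj_yE // => /and3P[_]; rewrite in_setD1 ux => /= uV yu.
have [->|uk] := eqVneq u k.
  by move=> _; rewrite adj_sym adj_xE // xV kV nkl /Order.comparable xk.
rewrite adjE // => /and3P[_ _ uk'].
rewrite adj_sym adj_xE // xV uV /=.
case/orP: yu => [/orP[yu|luy]|ul]; last first.
- by rewrite notin_lift ?lower_nge // /Order.comparable lower_ge.
- have : u < y by rewrite lt_neqAle uy.
  rewrite -(zipper_ltE hz) => ltux; rewrite /Order.comparable (ltW ltux) orbT /=.
  by rewrite notin_lift // lt_geF // (lt_trans ltux).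
have ku : k <= u.
  by case/orP: uk' => // luk; have := lower_ngey kl; rewrite (le_trans yu luk).
have zu : z <= u by rewrite (zipper_join hz) yu (le_trans xk ku).
move: uV; rewrite in_setD1 mem_proper => /andP[_ /andP[/negP[]]].
by rewrite -le1x -(lift_max hl) (lift_leE hl).
Qed.

(** Induction on the size of [I]: a maximal element other than x is flipped last, and removing it
    leaves a down-set of [lower]. *)
Lemma flips I : I \subset lower :\ k -> x \in I ->
  {in I & lower, forall u v, v <= u -> v \in I} ->
  pl_homeomorphic R (clique_complex (adj V1 [set x])) (clique_complex (adj V1 I)).
Proof.
have [n] := ubnP #|I|; elim: n I => // n IH I; rewrite ltnS => cardI Ilk xI down.
have [I0|/set0Pn[v0 v0I]] := eqVneq (I :\ x) set0.
  have -> : I = [set x] by rewrite -(setD1K xI) I0 setU0.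
  exact: pl_homeomorphic_eq.
have [v vI vmax] := @arg_maxnP _ v0 (mem (I :\ x)) (fun v => #|[set t | t <= v]|) v0I.
move: vI; rewrite /= in_setD1 => /andP[vx vI].
have Il : I \subset lower by apply: subset_trans Ilk (subsetDl _ _).
have vl := subsetP Il v vI.
have xI' : x \in I :\ v by rewrite in_setD1 eq_sym vx.
have above u : u \in I :\ v -> ~~ (v <= u).
  rewrite in_setD1 => /andP[uv uI]; apply/negP => vu.
  have ltvu : v < u by rewrite lt_neqAle eq_sym uv.
  have ux : u != x by rewrite gt_eqF // (le_lt_trans (lower_ge vl)).
  have := vmax u; rewrite /= in_setD1 ux uI => /(_ isT); apply/negP.
  rewrite -ltnNge; apply: proper_card; apply/properP; split.
    by apply/subsetP => s; rewrite !inE => /le_trans; apply.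
  by exists u; rewrite !inE // lt_geF.
apply: (@pl_homeomorphic_trans _ _ _ _ _ (clique_complex (adj V1 (I :\ v)))).
  apply: IH => //.
  - by rewrite (leq_trans _ cardI) // [X in (_ < X)%N](cardsD1 v) vI.
  - exact: subset_trans (subsetDl _ _) Ilk.
  - move=> u w uI' wl wu; rewrite in_setD1; apply/andP; split.
      by apply: contraNneq (above u uI') => <-.
    by move: uI'; rewrite in_setD1 => /andP[_ uI]; exact: down uI wl wu.
rewrite -{2}(setD1K vI); apply: flip => //.
- exact: subset_trans (subsetDl _ _) Il.
- by rewrite setD11.
- by have := subsetP Ilk v vI; rewrite in_setD1 => /andP[].
- move=> u ul uv; rewrite in_setD1 lt_eqF //=; exact: down vI ul (ltW uv).
Qed.

(** * Identification of the initial and final graphs *)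

Lemma comparability_cliques :
  pl_homeomorphic R (order_complex pp) (clique_complex (adj pp set0)).
Proof.
have adjE0 u v : adj pp set0 u v = [&& u \in pp, v \in pp & u >=< v].
  by rewrite /adj /cut /added imset0 !in_set0 !andbF andbT !orbF.
apply: pl_homeomorphic_eq => F; rewrite [LHS]inE; apply/andP/cliquesP.
  move=> [/subsetP Fpp /forall_inP ch] u v uF vF.
  by rewrite adjE0 !Fpp //; exact: (forall_inP (ch u uF)).
move=> h; split; first by apply/subsetP => u uF; have := h u u uF uF; rewrite adjE0 => /andP[].
apply/forall_inP => u uF; apply/forall_inP => v vF.
by have := h u v uF vF; rewrite adjE0 => /and3P[].
Qed.

(** The new element becomes y, the vertex of the zipper left once z and x are erased. *)
Definition zip_label (a : zipping hz) : P := if a is Some u then val u else y.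

Lemma zip_label_inj : injective zip_label.
Proof.
move=> [u|] [v|] //=; first by move=> /val_inj->.
  by move=> uy; have [_ /eqP/(_ uy)] := zip_neq u.
by move=> vy; have [_ /eqP/(_ (esym vy))] := zip_neq v.
Qed.

Lemma mem_zip_label a : (zip_label a \in V2) = (a \in proper_part (zipping hz)).
Proof.
rewrite !in_setD1 !in_setC1; case: a => [u|].
  have [ux _ uz] := zip_neq u.
  by rewrite [zip_label _ != x]ux [zip_label _ != z]uz.
rewrite /zip_label neq_yx (lt_eqF yz) /=.
by have := y_proper; rewrite mem_proper => /andP[-> ->].
Qed.

(** Comparability with y accounts for elements above y or below both; the added edges account for
    those above x but not above the join z. Together they give all relations of the new element. *)
Lemma adj_zip_label a b : a \in proper_part (zipping hz) -> b \in proper_part (zipping hz) ->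
  adj V2 lower (zip_label a) (zip_label b) = (a >=< b).
Proof.
move=> aP bP; have aV : zip_label a \in V2 by rewrite mem_zip_label.
have bV : zip_label b \in V2 by rewrite mem_zip_label.
have none_some (u : {v : P | v \notin [:: x; y; z]}) : val u \in V2 -> adj V2 lower y (val u) =
    ((None : zipping hz) >=< (Some u : zipping hz)).
  move=> uV; have [ux uy uz] := zip_neq u.
  have yV2 : y \in V2 by rewrite in_setD1 neq_yx y_V1.
  have -> : ((None : zipping hz) >=< (Some u : zipping hz)) =
      ((x <= val u) || (y <= val u)) || (val u <= x) by [].
  rewrite adj_yE // yV2 uV mem_lower /Order.comparable (zip_leE hz u) !andTb.
  have -> : (z <= val u) = (x <= val u) && (y <= val u) by exact: zipper_join hz _.
  by case: (x <= val u); case: (y <= val u); case: (val u <= y).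
case: a b {aP bP} aV bV => [u|] [v|] uV vV; last 1 first.
- by rewrite adj_refl // comparablexx.
- have [ux uy _] := zip_neq u; have [vx vy _] := zip_neq v.
  by rewrite adjE //= uV vV.
- by rewrite adj_sym none_some // comparable_sym.
- exact: none_some.
Qed.

Lemma zipped_cliques :
  pl_homeomorphic R (order_complex (proper_part (zipping hz))) (clique_complex (adj V2 lower)).
Proof.
apply: (@pl_homeomorphic_relabel _ _ _ zip_label) => [|F|F].
- exact: zip_label_inj.
- rewrite [LHS]inE; apply/andP/cliquesP => [[/subsetP FP /forall_inP ch]|h].
    move=> _ _ /imsetP[a aF ->] /imsetP[b bF ->].
    by rewrite adj_zip_label ?FP //; exact: (forall_inP (ch a aF)).
  have FP a : a \in F -> a \in proper_part (zipping hz).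
    move=> aF; have := h _ _ (imset_f zip_label aF) (imset_f zip_label aF).
    by rewrite -mem_zip_label => /andP[].
  split; first exact/subsetP.
  apply/forall_inP => a aF; apply/forall_inP => b bF.
  by rewrite -adj_zip_label ?FP // h ?imset_f.
move=> /cliquesP h; apply/subsetP => u uF; have := h u u uF uF => /andP[uV _].
apply/codomP; have [->|uy] := eqVneq u y; first by exists None.
move: uV; rewrite !in_setD1 => /and3P[ux uz _].
have unot : u \notin [:: x; y; z] by rewrite !inE !negb_or ux uy.
by exists (Some (exist _ u unot)).
Qed.

Lemma pl_homeomorphic_zipping :
  pl_homeomorphic R (order_complex pp) (order_complex (proper_part (zipping hz))).
Proof.
apply: pl_homeomorphic_trans comparability_cliques _.
apply: pl_homeomorphic_trans weld_z _.
apply: pl_homeomorphic_trans (pl_homeomorphic_sym zipped_cliques).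
apply: pl_homeomorphic_trans weld_x; apply: flips => //.
  by rewrite in_setD1 eq_sym k_neq_x x_lower.
(* [lower :\ k] is a down-set because k is the maximum of [lower]. *)
move=> u v; rewrite !in_setD1 => /andP[uk ul] vl vu; rewrite vl andbT.
by apply: contraNneq uk => vk; apply/eqP/le_anti; rewrite (lower_max hl) // -vk.
Qed.

End Moves.

Theorem theorem4p5 (R : realType) (disp : Order.disp_t)
    (P : finTBPOrderType disp) (x y z : P) (hz : clean_zipper x y z) (d : nat) :
  pl_ball R d (order_complex (proper_part P)) ->
  pl_ball R d (order_complex (proper_part (zipping (clean_zipper_proper hz)))).
Proof.
have [lift [k hl]] := lifting_exists hz.
apply: pl_homeomorphic_trans; apply: pl_homeomorphic_sym.
exact: pl_homeomorphic_zipping hl.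
Qed.
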